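(* Let $\mathcal A$ be a regular category and let $F\colon\mathbb A\to\mathbb B$ be a functor between groupoids in $\mathcal A$. Let $[B_0]$ be the discrete groupoid on the object of objects $B_0$ of $\mathbb B$, and let $N\colon[B_0]\to\mathbb B$ be the canonical embedding ($N_0=\mathrm{id}$, $N_1=e$). Let $[B_0]\times_{N,F}\mathbb A$, with projections $\widehat F\colon [B_0]\times_{N,F}\mathbb A\to[B_0]$ and $\widehat N\colon [B_0]\times_{N,F}\mathbb A\to\mathbb A$, be the pullback of $N$ and $F$ in the category of internal groupoids. Let $\mathbb V(F)$, with functors $F'\colon\mathbb V(F)\to[B_0]$ and $N'\colon\mathbb V(F)\to\mathbb A$ and natural transformation $v(F)\colon F'\cdot N\Rightarrow N'\cdot F$, be the strong h-pullback of $F$ and $N$ in $\mathbf{Grpd}(\mathcal A)$. Let $T\colon[B_0]\times_{N,F}\mathbb A\to\mathbb V(F)$ be the unique functor with $T\cdot F'=\widehat F$, $T\cdot N'=\widehat N$ and $T\cdot v(F)=\mathrm{id}$. Then: \begin{enumerate} \item $F$ is a fibration if and only if $T$ is a weak equivalence. \item $F$ is a split epi fibration if and only if $T$ is an equivalence. \end{enumerate}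
   Context: Composition is written diagrammatically: $f\cdot g$ means first $f$, then $g$. **Internal groupoids.** A groupoid $\mathbb B$ in $\mathcal A$ has object of objects $B_0$, object of arrows $B_1$, domain and codomain $d,c\colon B_1\rightrightarrows B_0$, identities $e\colon B_0\to B_1$, composition $m\colon B_1\times_{c,d}B_1\to B_1$ (where $B_1\times_{c,d}B_1$ has projections $\pi_1,\pi_2$ with $\pi_1\cdot c=\pi_2\cdot d$) and inverse $i\colon B_1\to B_1$, satisfying the usual axioms. A functor $F\colon\mathbb A\to\mathbb B$ is a pair $(F_0\colon A_0\to B_0,\ F_1\colon A_1\to B_1)$ compatible with the structure. A natural transformation $\alpha\colon F\Rightarrow G\colon\mathbb A\rightrightarrows\mathbb B$ is an arrow $\alpha\colon A_0\to B_1$ with $\alpha\cdot d=F_0$, $\alpha\cdot c=G_0$ and $\langle d\cdot\alpha,G_1\rangle\cdot m=\langle F_1,c\cdot\alpha\rangle\cdot m$. These form the 2-category $\mathbf{Grpd}(\mathcal A)$, in which all 2-cells are invertible. Pullbacks in its underlying category are level-wise. The discrete groupoid $[X]$ on $X$ has $X$ as object of objects and of arrows, with all structure maps identities. **Strong h-pullback.** A strong homotopy pullback (strong h-pullback) of $F\colon\mathbb A\to\mathbb B$ and $G\colon\mathbb C\to\mathbb B$ consists of an object $\mathbb P$, 1-cells $G'\colon\mathbb P\to\mathbb A$, $F'\colon\mathbb P\to\mathbb C$ and a 2-cell $\varphi\colon F'\cdot G\Rightarrow G'\cdot F$ such that: (a) for all $H\colon\mathbb X\to\mathbb A$, $K\colon\mathbb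 X\to\mathbb C$ and $\mu\colon K\cdot G\Rightarrow H\cdot F$ there is a unique $T\colon\mathbb X\to\mathbb P$ with $T\cdot G'=H$, $T\cdot F'=K$, $T\cdot\varphi=\mu$; (b) for all $L,M\colon\mathbb X\rightrightarrows\mathbb P$ and 2-cells $\alpha\colon L\cdot F'\Rightarrow M\cdot F'$, $\beta\colon L\cdot G'\Rightarrow M\cdot G'$ such that ($L\cdot\varphi$ followed by $\beta\cdot F$) equals ($\alpha\cdot G$ followed by $M\cdot\varphi$), there is a unique $\mu\colon L\Rightarrow M$ with $\mu\cdot F'=\alpha$ and $\mu\cdot G'=\beta$. Strong h-pullbacks exist in $\mathbf{Grpd}(\mathcal A)$ when $\mathcal A$ has pullbacks. **Classes of functors.** Let $F\colon\mathbb A\to\mathbb B$ be a functor. Let $A_0\times_{F_0,d}B_1$ be the pullback of $F_0$ and $d$, with projections $\alpha_d$ to $A_0$ and $\beta_d$ to $B_1$, and let $\tau_d\colon A_1\to A_0\times_{F_0,d}B_1$ be the unique arrow with $\tau_d\cdot\alpha_d=d$ and $\tau_d\cdot\beta_d=F_1$. - $F$ is a fibration (respectively a split epi fibration) if $\tau_d$ is a regular epimorphism (respectively a split epimorphism). - $F$ is fully faithful if $(d,F_1,c)$ exhibits $A_1$ as the limit of $A_0\xrightarrow{F_0}B_0\xleftarrow{d}B_1\xrightarrow{c}B_0\xleftarrow{F_0}A_0$. - $F$ is essentially surjective if $\beta_d\cdot c\colon A_0\times_{F_0,d}B_1\to B_0$ is a regular epimorphism. - $F$ is a weak equivalence if it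 is fully faithful and essentially surjective. - $F$ is an equivalence if it is an equivalence in the 2-category $\mathbf{Grpd}(\mathcal A)$; equivalently, it is fully faithful and $\beta_d\cdot c$ is a split epimorphism. *)

(* Defs.v *)
From Stdlib Require Import ClassicalEpsilon ProofIrrelevance.

Set Implicit Arguments.
Unset Strict Implicit.
Unset Printing Implicit Defensive.

Declare Scope cat_scope.
Delimit Scope cat_scope with cat.
Open Scope cat_scope.

Reserved Notation "a ~> b" (at level 90, no associativity).
Reserved Notation "f · g" (at level 40, left associativity).
Reserved Notation "F ⊙ G" (at level 40, left associativity).
Reserved Notation "F ==> G" (at level 90, no associativity).

(* Composition is diagrammatic throughout: [f · g] is first [f], then [g]. *)
Record category := Category {
  ob :> Type;
  hom : ob -> ob -> Type where "a ~> b" := (hom a b) : cat_scope;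
  idm : forall a, a ~> a;
  comp : forall a b c, (a ~> b) -> (b ~> c) -> (a ~> c)
    where "f · g" := (comp f g) : cat_scope;
  comp_id_l : forall a b (f : a ~> b), idm a · f = f;
  comp_id_r : forall a b (f : a ~> b), f · idm b = f;
  comp_assoc : forall a b c d (f : a ~> b) (g : b ~> c) (h : c ~> d),
    (f · g) · h = f · (g · h) }.

Arguments hom {c} _ _ : rename.
Arguments idm {c} a : rename.
Arguments comp {c} {x y z} f g : rename.

Notation "a ~> b" := (hom a b) : cat_scope.
Notation "f · g" := (comp f g) : cat_scope.

Section Limits.
Context {C : category}.

Record is_pullback {A B D P : C} (f : A ~> D) (g : B ~> D)
    (p : P ~> A) (q : P ~> B) : Prop := IsPullback {
  pb_comm : p · f = q · g;
  pb_univ : forall (X : C) (x : X ~> A) (y : X ~> B), x · f = y · g ->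
    exists! u : X ~> P, u · p = x /\ u · q = y }.

(* [pb_pair pb h] is the arrow <x, y> into the pullback; it does not depend on
   the proof [h] of compatibility. *)
Definition pb_pair {A B D P : C} {f : A ~> D} {g : B ~> D}
    {p : P ~> A} {q : P ~> B} (pb : is_pullback f g p q)
    {X : C} {x : X ~> A} {y : X ~> B} (h : x · f = y · g) : X ~> P :=
  proj1_sig (constructive_indefinite_description _ (pb_univ pb h)).

Lemma pair_fst {A B D P : C} {f : A ~> D} {g : B ~> D}
    {p : P ~> A} {q : P ~> B} (pb : is_pullback f g p q)
    {X : C} {x : X ~> A} {y : X ~> B} (h : x · f = y · g) : pb_pair pb h · p = x.
Proof.
  unfold pb_pair; destruct constructive_indefinite_description as [u [[Hp Hq] Hu]].
  exact Hp.
Qed.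

Lemma pair_snd {A B D P : C} {f : A ~> D} {g : B ~> D}
    {p : P ~> A} {q : P ~> B} (pb : is_pullback f g p q)
    {X : C} {x : X ~> A} {y : X ~> B} (h : x · f = y · g) : pb_pair pb h · q = y.
Proof.
  unfold pb_pair; destruct constructive_indefinite_description as [u [[Hp Hq] Hu]].
  exact Hq.
Qed.

Lemma pullback_ext {A B D P : C} {f : A ~> D} {g : B ~> D}
    {p : P ~> A} {q : P ~> B} (pb : is_pullback f g p q)
    {X : C} (u v : X ~> P) : u · p = v · p -> u · q = v · q -> u = v.
Proof.
  intros Hp Hq.
  assert (h : (v · p) · f = (v · q) · g)
    by (rewrite !comp_assoc, (pb_comm pb); reflexivity).
  destruct (pb_univ pb h) as [w [_ Hw]].
  rewrite <- (Hw u (conj Hp Hq)), <- (Hw v (conj eq_refl eq_refl)); reflexivity.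
Qed.

(* [L], with legs [p], [q], [r], is the limit of
   A --f--> D <--g-- B --h--> E <--k-- A'. *)
Record is_zigzag_limit {A B A' D E L : C}
    (f : A ~> D) (g : B ~> D) (h : B ~> E) (k : A' ~> E)
    (p : L ~> A) (q : L ~> B) (r : L ~> A') : Prop := IsZigzagLimit {
  zl_comm_l : p · f = q · g;
  zl_comm_r : q · h = r · k;
  zl_univ : forall (X : C) (x : X ~> A) (y : X ~> B) (z : X ~> A'),
    x · f = y · g -> y · h = z · k ->
    exists! u : X ~> L, u · p = x /\ u · q = y /\ u · r = z }.

Definition is_terminal (T : C) : Prop :=
  forall X : C, exists! u : X ~> T, True.

Record is_coequalizer {W X Y : C} (u v : W ~> X) (f : X ~> Y) : Prop :=
  IsCoequalizer {
  coeq_comm : u · f = v · f;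
  coeq_univ : forall (Z : C) (g : X ~> Z), u · g = v · g ->
    exists! h : Y ~> Z, f · h = g }.

Definition is_regular_epi {X Y : C} (f : X ~> Y) : Prop :=
  exists (W : C) (u v : W ~> X), is_coequalizer u v f.

Definition is_split_epi {X Y : C} (f : X ~> Y) : Prop :=
  exists s : Y ~> X, s · f = idm Y.

End Limits.

(* Finite limits are given as a terminal object together with pullbacks. *)
Record is_regular_category (C : category) : Prop := IsRegularCategory {
  reg_terminal : exists T : C, is_terminal T;
  reg_pullback : forall (A B D : C) (f : A ~> D) (g : B ~> D),
    exists (P : C) (p : P ~> A) (q : P ~> B), is_pullback f g p q;
  reg_coequalizer : forall (X Y K : C) (f : X ~> Y) (k1 k2 : K ~> X),
    is_pullback f f k1 k2 ->
    exists (Q : C) (q : X ~> Q), is_coequalizer k1 k2 q;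
  reg_epi_stable : forall (A B D P : C) (f : A ~> D) (g : B ~> D)
    (p : P ~> A) (q : P ~> B),
    is_pullback f g p q -> is_regular_epi f -> is_regular_epi q }.

(* In the laws below, the quantified compatibility proofs [h : _ = _] only make
   the pairing well typed: each is derivable from the preceding fields.
   Associativity is stated on generalized composable triples (f, g, h), that
   is, on maps into the object of composable triples. *)
Record groupoid (C : category) := Groupoid {
  g0 : C;
  g1 : C;
  g2 : C;
  gd : g1 ~> g0;
  gc : g1 ~> g0;
  ge : g0 ~> g1;
  gp1 : g2 ~> g1;
  gp2 : g2 ~> g1;
  g_pb : is_pullback gc gd gp1 gp2;
  gm : g2 ~> g1;
  gi : g1 ~> g1;
  ge_d : ge · gd = idm g0;
  ge_c : ge · gc = idm g0;
  gm_d : gm · gd = gp1 · gd;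
  gm_c : gm · gc = gp2 · gc;
  gi_d : gi · gd = gc;
  gi_c : gi · gc = gd;
  gm_id_l : forall h : (gd · ge) · gc = idm g1 · gd,
    pb_pair g_pb h · gm = idm g1;
  gm_id_r : forall h : idm g1 · gc = (gc · ge) · gd,
    pb_pair g_pb h · gm = idm g1;
  gm_assoc : forall (X : C) (f g h : X ~> g1)
    (fg : f · gc = g · gd) (gh : g · gc = h · gd)
    (fg_h : (pb_pair g_pb fg · gm) · gc = h · gd)
    (f_gh : f · gc = (pb_pair g_pb gh · gm) · gd),
    pb_pair g_pb fg_h · gm = pb_pair g_pb f_gh · gm;
  gm_inv_r : forall h : idm g1 · gc = gi · gd,
    pb_pair g_pb h · gm = gd · ge;
  gm_inv_l : forall h : gi · gc = idm g1 · gd,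
    pb_pair g_pb h · gm = gc · ge }.

Arguments g0 {C} _.
Arguments g1 {C} _.
Arguments g2 {C} _.
Arguments gd {C} _.
Arguments gc {C} _.
Arguments ge {C} _.
Arguments gp1 {C} _.
Arguments gp2 {C} _.
Arguments gm {C} _.
Arguments gi {C} _.
Arguments g_pb {C} _.

(* The composite <f, g> · m of generalized arrows of [B]. *)
Definition gcomp {C : category} {B : groupoid C} {X : C} {f g : X ~> g1 B}
    (h : f · gc B = g · gd B) : X ~> g1 B :=
  pb_pair (g_pb B) h · gm B.

(* Preservation of inverses is a consequence of the other laws. *)
Record functor {C : category} (A B : groupoid C) := Functor {
  f0 : g0 A ~> g0 B;
  f1 : g1 A ~> g1 B;
  f_d : f1 · gd B = gd A · f0;
  f_c : f1 · gc B = gc A · f0;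
  f_e : ge A · f1 = f0 · ge B;
  f_m : forall h : (gp1 A · f1) · gc B = (gp2 A · f1) · gd B,
    gm A · f1 = gcomp h }.

(* In a natural transformation [F ==> G], the compatibility proofs are
   derivable, as above. *)
Record nat_trans {C : category} {A B : groupoid C} (F G : functor A B) :=
  NatTrans {
  nt :> g0 A ~> g1 B;
  nt_d : nt · gd B = f0 F;
  nt_c : nt · gc B = f0 G;
  nt_nat : forall (h : (gd A · nt) · gc B = f1 G · gd B)
    (k : f1 F · gc B = (gc A · nt) · gd B), gcomp h = gcomp k }.

Notation "F ==> G" := (nat_trans F G) : cat_scope.

(* Equality of 2-cells whose 1-cell boundaries agree only propositionally
   (e.g. up to associativity of composition). *)
Definition cell_eq {C : category} {A B : groupoid C} {F G F' G' : functor A B}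
    (a : F ==> G) (b : F' ==> G') : Prop := nt a = nt b.

Section Grpd.
Context {C : category}.

Lemma functor_ext {A B : groupoid C} (F G : functor A B) :
  f0 F = f0 G -> f1 F = f1 G -> F = G.
Proof.
  destruct F, G; simpl; intros; subst; f_equal; apply proof_irrelevance.
Qed.

Lemma nat_trans_ext {A B : groupoid C} {F G : functor A B} (a b : F ==> G) :
  nt a = nt b -> a = b.
Proof.
  destruct a, b; simpl; intros; subst; f_equal; apply proof_irrelevance.
Qed.

Lemma gcomp_eq {B : groupoid C} {X : C} {f g f' g' : X ~> g1 B}
    (h : f · gc B = g · gd B) (h' : f' · gc B = g' · gd B) :
  f = f' -> g = g' -> gcomp h = gcomp h'.
Proof. intros; subst; f_equal; apply proof_irrelevance. Qed.

Lemma gcomp_d {B : groupoid C} {X : C} {f g : X ~> g1 B}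
    (h : f · gc B = g · gd B) : gcomp h · gd B = f · gd B.
Proof.
  unfold gcomp; rewrite comp_assoc, gm_d, <- comp_assoc, pair_fst; reflexivity.
Qed.

Lemma gcomp_c {B : groupoid C} {X : C} {f g : X ~> g1 B}
    (h : f · gc B = g · gd B) : gcomp h · gc B = g · gc B.
Proof.
  unfold gcomp; rewrite comp_assoc, gm_c, <- comp_assoc, pair_snd; reflexivity.
Qed.

Lemma comp_pair {A B D P : C} {f : A ~> D} {g : B ~> D}
    {p : P ~> A} {q : P ~> B} (pb : is_pullback f g p q) {X Y : C} (u : Y ~> X)
    {x : X ~> A} {y : X ~> B} (h : x · f = y · g)
    (h' : (u · x) · f = (u · y) · g) : u · pb_pair pb h = pb_pair pb h'.
Proof.
  apply (pullback_ext pb); rewrite comp_assoc, ?pair_fst, ?pair_snd; reflexivity.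
Qed.

Lemma comp_gcomp {B : groupoid C} {X Y : C} (u : Y ~> X) {f g : X ~> g1 B}
    (h : f · gc B = g · gd B) (h' : (u · f) · gc B = (u · g) · gd B) :
  u · gcomp h = gcomp h'.
Proof.
  unfold gcomp; rewrite <- comp_assoc, (comp_pair (g_pb B) h h'); reflexivity.
Qed.

Lemma gcomp_assoc {B : groupoid C} {X : C} {f g k : X ~> g1 B}
    (fg : f · gc B = g · gd B) (gk : g · gc B = k · gd B)
    (fg_k : gcomp fg · gc B = k · gd B) (f_gk : f · gc B = gcomp gk · gd B) :
  gcomp fg_k = gcomp f_gk.
Proof. exact (gm_assoc fg_k f_gk). Qed.

Lemma gcomp_id_l {B : groupoid C} {X : C} {f : X ~> g1 B} {u : X ~> g0 B}
    (h : (u · ge B) · gc B = f · gd B) : gcomp h = f.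
Proof.
  assert (k : (gd B · ge B) · gc B = idm (g1 B) · gd B)
    by (rewrite comp_assoc, ge_c, comp_id_l, comp_id_r; reflexivity).
  assert (Hu : u = f · gd B)
    by (rewrite comp_assoc, ge_c, comp_id_r in h; exact h).
  subst u.
  assert (k' : (f · (gd B · ge B)) · gc B = (f · idm (g1 B)) · gd B)
    by (rewrite comp_id_r, <- comp_assoc; exact h).
  transitivity (f · gcomp k).
  - rewrite (comp_gcomp k k').
    apply gcomp_eq; [apply comp_assoc | symmetry; apply comp_id_r].
  - unfold gcomp; rewrite gm_id_l; apply comp_id_r.
Qed.

Lemma gcomp_id_r {B : groupoid C} {X : C} {f : X ~> g1 B} {u : X ~> g0 B}
    (h : f · gc B = (u · ge B) · gd B) : gcomp h = f.
Proof.
  assert (k : idm (g1 B) · gc B = (gc B · ge B) · gd B)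
    by (rewrite comp_assoc, ge_d, comp_id_l, comp_id_r; reflexivity).
  assert (Hu : u = f · gc B)
    by (rewrite comp_assoc, ge_d, comp_id_r in h; symmetry; exact h).
  subst u.
  assert (k' : (f · idm (g1 B)) · gc B = (f · (gc B · ge B)) · gd B)
    by (rewrite comp_id_r, <- comp_assoc; exact h).
  transitivity (f · gcomp k).
  - rewrite (comp_gcomp k k').
    apply gcomp_eq; [symmetry; apply comp_id_r | apply comp_assoc].
  - unfold gcomp; rewrite gm_id_r; apply comp_id_r.
Qed.

Lemma functor_compat {A B : groupoid C} (F : functor A B) {X : C}
    {f g : X ~> g1 A} (h : f · gc A = g · gd A) :
  (f · f1 F) · gc B = (g · f1 F) · gd B.
Proof.
  rewrite !comp_assoc, f_c, f_d, <- !comp_assoc, h; reflexivity.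
Qed.

Lemma gcomp_functor {A B : groupoid C} (F : functor A B) {X : C}
    {f g : X ~> g1 A} (h : f · gc A = g · gd A)
    (h' : (f · f1 F) · gc B = (g · f1 F) · gd B) :
  gcomp h · f1 F = gcomp h'.
Proof.
  unfold gcomp at 1; rewrite comp_assoc.
  rewrite (f_m (functor_compat F (pb_comm (g_pb A)))).
  assert (k : (pb_pair (g_pb A) h · (gp1 A · f1 F)) · gc B
              = (pb_pair (g_pb A) h · (gp2 A · f1 F)) · gd B)
    by (rewrite <- !comp_assoc, pair_fst, pair_snd; exact h').
  rewrite (comp_gcomp _ k).
  apply gcomp_eq; rewrite <- comp_assoc, ?pair_fst, ?pair_snd; reflexivity.
Qed.

Definition fid (A : groupoid C) : functor A A.
Proof.
  refine (@Functor C A A (idm _) (idm _) _ _ _ _).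
  - rewrite comp_id_l, comp_id_r; reflexivity.
  - rewrite comp_id_l, comp_id_r; reflexivity.
  - rewrite comp_id_l, comp_id_r; reflexivity.
  - intros h; unfold gcomp; rewrite comp_id_r.
    transitivity (idm _ · gm A); [symmetry; apply comp_id_l|]; f_equal.
    apply (pullback_ext (g_pb A));
      rewrite ?pair_fst, ?pair_snd, comp_id_l, comp_id_r; reflexivity.
Defined.

Definition fcomp {A B D : groupoid C} (F : functor A B) (G : functor B D) :
  functor A D.
Proof.
  refine (@Functor C A D (f0 F · f0 G) (f1 F · f1 G) _ _ _ _).
  - rewrite comp_assoc, f_d, <- !comp_assoc, f_d; reflexivity.
  - rewrite comp_assoc, f_c, <- !comp_assoc, f_c; reflexivity.
  - rewrite <- comp_assoc, f_e, !comp_assoc, f_e; reflexivity.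
  - intros h.
    pose proof (functor_compat F (pb_comm (g_pb A))) as k.
    rewrite <- comp_assoc, (f_m k), (gcomp_functor k (functor_compat G k)).
    apply gcomp_eq; apply comp_assoc.
Defined.

Notation "F ⊙ G" := (fcomp F G) : cat_scope.

Lemma fcomp_assoc {A B D E : groupoid C}
    (F : functor A B) (G : functor B D) (H : functor D E) :
  (F ⊙ G) ⊙ H = F ⊙ (G ⊙ H).
Proof. apply functor_ext; apply comp_assoc. Qed.

Lemma fcomp_id_l {A B : groupoid C} (F : functor A B) : fid A ⊙ F = F.
Proof. apply functor_ext; apply comp_id_l. Qed.

Lemma fcomp_id_r {A B : groupoid C} (F : functor A B) : F ⊙ fid B = F.
Proof. apply functor_ext; apply comp_id_r. Qed.

Definition id_cell {A B : groupoid C} (F : functor A B) : F ==> F.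
Proof.
  refine (@NatTrans C A B F F (f0 F · ge B) _ _ _).
  - rewrite comp_assoc, ge_d; apply comp_id_r.
  - rewrite comp_assoc, ge_c; apply comp_id_r.
  - intros h k.
    assert (h' : ((gd A · f0 F) · ge B) · gc B = f1 F · gd B)
      by (rewrite (comp_assoc (gd A)); exact h).
    assert (k' : f1 F · gc B = ((gc A · f0 F) · ge B) · gd B)
      by (rewrite (comp_assoc (gc A)); exact k).
    transitivity (f1 F).
    + transitivity (gcomp h'); [|apply gcomp_id_l].
      apply gcomp_eq; [symmetry; apply comp_assoc | reflexivity].
    + transitivity (gcomp k'); [symmetry; apply gcomp_id_r|].
      apply gcomp_eq; [reflexivity | apply comp_assoc].
Defined.

Lemma vcomp_compat {A B : groupoid C} {F G H : functor A B}
    (a : F ==> G) (b : G ==> H) : a · gc B = b · gd B.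
Proof. rewrite nt_c, nt_d; reflexivity. Qed.

Definition vcomp {A B : groupoid C} {F G H : functor A B}
    (a : F ==> G) (b : G ==> H) : F ==> H.
Proof.
  refine (@NatTrans C A B F H (gcomp (vcomp_compat a b)) _ _ _).
  - rewrite gcomp_d; apply nt_d.
  - rewrite gcomp_c; apply nt_c.
  - intros h k.
    assert (da_db : (gd A · a) · gc B = (gd A · b) · gd B)
      by (rewrite !comp_assoc, nt_c, nt_d; reflexivity).
    assert (ca_cb : (gc A · a) · gc B = (gc A · b) · gd B)
      by (rewrite !comp_assoc, nt_c, nt_d; reflexivity).
    assert (db_H : (gd A · b) · gc B = f1 H · gd B)
      by (rewrite comp_assoc, nt_c, f_d; reflexivity).
    assert (da_G : (gd A · a) · gc B = f1 G · gd B)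
      by (rewrite comp_assoc, nt_c, f_d; reflexivity).
    assert (G_cb : f1 G · gc B = (gc A · b) · gd B)
      by (rewrite comp_assoc, nt_d, f_c; reflexivity).
    assert (F_ca : f1 F · gc B = (gc A · a) · gd B)
      by (rewrite comp_assoc, nt_d, f_c; reflexivity).
    assert (e1 : gcomp da_db · gc B = f1 H · gd B)
      by (rewrite gcomp_c; exact db_H).
    assert (e2 : (gd A · a) · gc B = gcomp db_H · gd B)
      by (rewrite gcomp_d; exact da_db).
    assert (e3 : (gd A · a) · gc B = gcomp G_cb · gd B)
      by (rewrite gcomp_d; exact da_G).
    assert (e4 : gcomp da_G · gc B = (gc A · b) · gd B)
      by (rewrite gcomp_c; exact G_cb).
    assert (e5 : gcomp F_ca · gc B = (gc A · b) · gd B)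
      by (rewrite gcomp_c; exact ca_cb).
    assert (e6 : f1 F · gc B = gcomp ca_cb · gd B)
      by (rewrite gcomp_d; exact F_ca).
    transitivity (gcomp e1).
    { apply gcomp_eq; [apply comp_gcomp | reflexivity]. }
    rewrite (gcomp_assoc e1 e2).
    transitivity (gcomp e3).
    { apply gcomp_eq; [reflexivity | apply nt_nat]. }
    rewrite <- (gcomp_assoc e4 e3).
    transitivity (gcomp e5).
    { apply gcomp_eq; [apply nt_nat | reflexivity]. }
    rewrite (gcomp_assoc e5 e6).
    apply gcomp_eq; [reflexivity | symmetry; apply comp_gcomp].
Defined.

Definition whisker_l {X A B : groupoid C} (L : functor X A) {F G : functor A B}
    (a : F ==> G) : L ⊙ F ==> L ⊙ G.
Proof.
  refine (@NatTrans C X B (L ⊙ F) (L ⊙ G) (f0 L · a) _ _ _).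
  - rewrite comp_assoc, nt_d; reflexivity.
  - rewrite comp_assoc, nt_c; reflexivity.
  - intros h k.
    assert (p : (gd A · a) · gc B = f1 G · gd B)
      by (rewrite comp_assoc, nt_c, f_d; reflexivity).
    assert (q : f1 F · gc B = (gc A · a) · gd B)
      by (rewrite comp_assoc, nt_d, f_c; reflexivity).
    assert (p' : (f1 L · (gd A · a)) · gc B = (f1 L · f1 G) · gd B)
      by (rewrite !comp_assoc, nt_c, f_d; reflexivity).
    assert (q' : (f1 L · f1 F) · gc B = (f1 L · (gc A · a)) · gd B)
      by (rewrite !comp_assoc, nt_d, f_c; reflexivity).
    transitivity (f1 L · gcomp p); [|rewrite (nt_nat p q)].
    + rewrite (comp_gcomp p p'); apply gcomp_eq; [|reflexivity].
      rewrite <- !comp_assoc, f_d; reflexivity.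
    + rewrite (comp_gcomp q q'); apply gcomp_eq; [reflexivity|].
      rewrite <- !comp_assoc, f_c; reflexivity.
Defined.

Definition whisker_r {A B D : groupoid C} {F G : functor A B}
    (a : F ==> G) (H : functor B D) : F ⊙ H ==> G ⊙ H.
Proof.
  refine (@NatTrans C A D (F ⊙ H) (G ⊙ H) (a · f1 H) _ _ _).
  - rewrite comp_assoc, f_d, <- comp_assoc, nt_d; reflexivity.
  - rewrite comp_assoc, f_c, <- comp_assoc, nt_c; reflexivity.
  - intros h k.
    assert (p : (gd A · a) · gc B = f1 G · gd B)
      by (rewrite comp_assoc, nt_c, f_d; reflexivity).
    assert (q : f1 F · gc B = (gc A · a) · gd B)
      by (rewrite comp_assoc, nt_d, f_c; reflexivity).
    transitivity (gcomp p · f1 H); [|rewrite (nt_nat p q)].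
    + rewrite (gcomp_functor p (functor_compat H p)).
      apply gcomp_eq; [symmetry; apply comp_assoc | reflexivity].
    + rewrite (gcomp_functor q (functor_compat H q)).
      apply gcomp_eq; [reflexivity | apply comp_assoc].
Defined.

(* Transport of a 2-cell along equalities of its boundary; the underlying
   arrow is unchanged definitionally. *)
Definition cell_cast {A B : groupoid C} {F G F' G' : functor A B}
    (eF : F = F') (eG : G = G') (a : F ==> G) : F' ==> G'.
Proof.
  refine (@NatTrans C A B F' G' (nt a) _ _ _).
  - rewrite <- eF; apply nt_d.
  - rewrite <- eG; apply nt_c.
  - rewrite <- eF, <- eG; apply nt_nat.
Defined.

Definition is_invertible_cell {A B : groupoid C} {F G : functor A B}
    (a : F ==> G) : Prop :=
  exists b : G ==> F, vcomp a b = id_cell F /\ vcomp b a = id_cell G.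

End Grpd.

Notation "F ⊙ G" := (fcomp F G) : cat_scope.

(* The underlying category of the 2-category of internal groupoids. *)
Definition Grpd (C : category) : category :=
  @Category (groupoid C) (@functor C) (@fid C) (@fcomp C)
    (@fcomp_id_l C) (@fcomp_id_r C) (@fcomp_assoc C).

Section Classes.
Context {C : category}.

Definition is_equivalence {A B : groupoid C} (F : functor A B) : Prop :=
  exists (G : functor B A) (a : F ⊙ G ==> fid A) (b : G ⊙ F ==> fid B),
    is_invertible_cell a /\ is_invertible_cell b.

Lemma tau_compat {A B : groupoid C} (F : functor A B) :
  gd A · f0 F = f1 F · gd B.
Proof. symmetry; apply f_d. Qed.

(* Pullbacks being unique up to isomorphism, the choice of the pullback of
   [f0 F] and [gd B] in the next three definitions is immaterial; [pb_pair] gives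
   the arrow tau_d. *)
Definition is_fibration {A B : groupoid C} (F : functor A B) : Prop :=
  exists (P : C) (ad : P ~> g0 A) (bd : P ~> g1 B)
    (pb : is_pullback (f0 F) (gd B) ad bd),
    is_regular_epi (pb_pair pb (tau_compat F)).

Definition is_split_epi_fibration {A B : groupoid C} (F : functor A B) : Prop :=
  exists (P : C) (ad : P ~> g0 A) (bd : P ~> g1 B)
    (pb : is_pullback (f0 F) (gd B) ad bd),
    is_split_epi (pb_pair pb (tau_compat F)).

Definition is_essentially_surjective {A B : groupoid C} (F : functor A B) :
    Prop :=
  exists (P : C) (ad : P ~> g0 A) (bd : P ~> g1 B),
    is_pullback (f0 F) (gd B) ad bd /\ is_regular_epi (bd · gc B).

Definition is_fully_faithful {A B : groupoid C} (F : functor A B) : Prop :=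
  is_zigzag_limit (f0 F) (gd B) (gc B) (f0 F) (gd A) (f1 F) (gc A).

Definition is_weak_equivalence {A B : groupoid C} (F : functor A B) : Prop :=
  is_fully_faithful F /\ is_essentially_surjective F.

(* In [shp_cell], [cell_cast] only reassociates composites of functors. *)
Record is_strong_h_pullback {A B D P : groupoid C}
    (F : functor A B) (G : functor D B)
    (G' : functor P A) (F' : functor P D) (phi : F' ⊙ G ==> G' ⊙ F) : Prop :=
  IsStrongHPullback {
  shp_functor : forall (X : groupoid C) (H : functor X A) (K : functor X D)
    (mu : K ⊙ G ==> H ⊙ F),
    exists! T : functor X P,
      T ⊙ G' = H /\ T ⊙ F' = K /\ cell_eq (whisker_l T phi) mu;
  shp_cell : forall (X : groupoid C) (L M : functor X P)
    (a : L ⊙ F' ==> M ⊙ F') (b : L ⊙ G' ==> M ⊙ G'),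
    let reassoc (S : functor X P) : (S ⊙ F') ⊙ G ==> (S ⊙ G') ⊙ F :=
      cell_cast (eq_sym (fcomp_assoc S F' G)) (eq_sym (fcomp_assoc S G' F))
        (whisker_l S phi) in
    vcomp (reassoc L) (whisker_r b F) = vcomp (whisker_r a G) (reassoc M) ->
    exists! mu : L ==> M, whisker_r mu F' = a /\ whisker_r mu G' = b }.

Lemma id_pullback (X : C) : is_pullback (idm X) (idm X) (idm X) (idm X).
Proof.
  split; [reflexivity|].
  intros Y x y h; rewrite !comp_id_r in h; subst y.
  exists x; split; [split; apply comp_id_r|].
  intros u [Hu _]; rewrite <- Hu; apply comp_id_r.
Qed.

Lemma id_pullback_pair {X Y : C} {x y : Y ~> X} (h : x · idm X = y · idm X) :
  pb_pair (id_pullback X) h = x.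
Proof. rewrite <- (pair_fst (id_pullback X) h), comp_id_r; reflexivity. Qed.

Definition discrete (X : C) : groupoid C.
Proof.
  refine (@Groupoid C X X X (idm X) (idm X) (idm X) (idm X) (idm X)
    (id_pullback X) (idm X) (idm X) _ _ _ _ _ _ _ _ _ _ _);
  intros; rewrite ?id_pullback_pair, ?comp_id_r; reflexivity.
Defined.

Definition discrete_incl (B : groupoid C) : functor (discrete (g0 B)) B.
Proof.
  refine (@Functor C (discrete (g0 B)) B (idm _) (ge B) _ _ _ _); simpl.
  - rewrite ge_d, comp_id_l; reflexivity.
  - rewrite ge_c, comp_id_l; reflexivity.
  - reflexivity.
  - intros h.
    assert (k : (idm (g0 B) · ge B) · gc B = (idm (g0 B) · ge B) · gd B)
      by (rewrite comp_id_l, ge_c, ge_d; reflexivity).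
    transitivity (gcomp k); [|apply gcomp_eq; reflexivity].
    symmetry; rewrite (gcomp_id_r k); reflexivity.
Defined.

End Classes.

(* Main.v *)
Require Import Defs.
From Stdlib Require Import ClassicalEpsilon.

(** Read on generalized elements, an object of V(F) is a triple
    (y, b : y -> F x, x), and an arrow (y, b, x) -> (y', b', x') exists only if
    y = y'; it is then an arrow f : x -> x' of A with b F(f) = b'. The groupoid
    [B_0] x_{N,F} A consists of the objects of A and of those arrows that F
    sends to identities, and T sends x to (F x, id, x). Hence T is always fully
    faithful: an arrow of V(F) between two such objects is exactly an f with
    F(f) an identity ([comparison_fully_faithful]).

    It remains to read off essential surjectivity. An arrow of V(F) that starts
    at T x is determined by its component f : x -> x', and its target is then
    (F x, F(f), x'). So the pullback of T_0 and d is the object A_1, and beta_d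
    followed by c becomes the arrow tau_c : A_1 -> V(F)_0, f |-> (F(f), c f)
    ([comparison_objects]). Since V(F)_0 is the pullback of F_0 and c, passing to
    inverses both in A and in B identifies tau_c with tau_d. Any class of arrows
    that is invariant under isomorphism therefore contains tau_d if and only if
    it contains beta_d . c for T ([fibration_iff_surjective]).

    Regular epimorphisms give the first statement. For split epimorphisms one
    needs moreover that a fully faithful functor is an equivalence exactly when
    beta_d . c splits ([equivalence_iff_split]): a section chooses for each
    object b of the target an object s b and an arrow F(s b) -> b, and
    full faithfulness turns this choice into a quasi-inverse.

    These descriptions come from universal properties quantified over
    groupoids. For the strong h-pullback it suffices to test on discrete
    groupoids, since functors and 2-cells out of [X] are maps out of X
    ([shp_objects], [shp_arrows]). Discrete groupoids do not see the arrows of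
    the strict pullback; there one compares with the pullback computed levelwise
    ([pullback_levelwise]). *)

Set Implicit Arguments.
Unset Strict Implicit.
Unset Printing Implicit Defensive.

(** * Calculus of generalized arrows in an internal groupoid *)

Section Composition.
Context {C : category}.

Lemma f_d_r {A B : groupoid C} (F : functor A B) {X : C} (w : g0 B ~> X) :
  f1 F · (gd B · w) = gd A · (f0 F · w).
Proof. rewrite <- !comp_assoc, f_d; reflexivity. Qed.

Lemma f_c_r {A B : groupoid C} (F : functor A B) {X : C} (w : g0 B ~> X) :
  f1 F · (gc B · w) = gc A · (f0 F · w).
Proof. rewrite <- !comp_assoc, f_c; reflexivity. Qed.

Lemma ge_d_r (B : groupoid C) {X : C} (w : g0 B ~> X) : ge B · (gd B · w) = w.
Proof. rewrite <- comp_assoc, ge_d; apply comp_id_l. Qed.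

Lemma ge_c_r (B : groupoid C) {X : C} (w : g0 B ~> X) : ge B · (gc B · w) = w.
Proof. rewrite <- comp_assoc, ge_c; apply comp_id_l. Qed.

Lemma gi_d_r (B : groupoid C) {X : C} (w : g0 B ~> X) :
  gi B · (gd B · w) = gc B · w.
Proof. rewrite <- comp_assoc, gi_d; reflexivity. Qed.

Lemma gi_c_r (B : groupoid C) {X : C} (w : g0 B ~> X) :
  gi B · (gc B · w) = gd B · w.
Proof. rewrite <- comp_assoc, gi_c; reflexivity. Qed.

(** Extending the composition of generalized arrows by an arbitrary value to
    non-composable pairs removes the compatibility proof from the terms, so that
    composites can be rewritten freely and composability is only a side
    condition of the laws. *)
Definition mul {B : groupoid C} {X : C} (f g : X ~> g1 B) : X ~> g1 B :=
  match excluded_middle_informative (f · gc B = g · gd B) with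
  | left h => gcomp h
  | right _ => f
  end.

Lemma gcompE {B : groupoid C} {X : C} {f g : X ~> g1 B}
    (h : f · gc B = g · gd B) : gcomp h = mul f g.
Proof.
  unfold mul; destruct excluded_middle_informative as [k|n].
  - apply gcomp_eq; reflexivity.
  - contradiction.
Qed.

Lemma gmE (B : groupoid C) : gm B = mul (gp1 B) (gp2 B).
Proof.
  rewrite <- (gcompE (pb_comm (g_pb B))); unfold gcomp.
  rewrite <- (comp_id_l (gm B)) at 1; f_equal.
  apply (pullback_ext (g_pb B)); rewrite ?pair_fst, ?pair_snd; apply comp_id_l.
Qed.

Lemma mul_d {B : groupoid C} {X : C} {f g : X ~> g1 B} :
  f · gc B = g · gd B -> mul f g · gd B = f · gd B.
Proof. intros h; rewrite <- (gcompE h); apply gcomp_d. Qed.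

Lemma mul_c {B : groupoid C} {X : C} {f g : X ~> g1 B} :
  f · gc B = g · gd B -> mul f g · gc B = g · gc B.
Proof. intros h; rewrite <- (gcompE h); apply gcomp_c. Qed.

Lemma comp_mul {B : groupoid C} {X Y : C} (u : Y ~> X) {f g : X ~> g1 B} :
  f · gc B = g · gd B -> u · mul f g = mul (u · f) (u · g).
Proof.
  intros h.
  assert (h' : (u · f) · gc B = (u · g) · gd B)
    by (rewrite !comp_assoc, h; reflexivity).
  rewrite <- (gcompE h), <- (gcompE h'); apply comp_gcomp.
Qed.

Lemma mul_assoc {B : groupoid C} {X : C} {f g k : X ~> g1 B} :
  f · gc B = g · gd B -> g · gc B = k · gd B ->
  mul (mul f g) k = mul f (mul g k).
Proof.
  intros fg gk.
  assert (h1 : gcomp fg · gc B = k · gd B) by (rewrite gcomp_c; exact gk).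
  assert (h2 : f · gc B = gcomp gk · gd B) by (rewrite gcomp_d; exact fg).
  rewrite <- (gcompE fg), <- (gcompE gk), <- (gcompE h1), <- (gcompE h2).
  apply gcomp_assoc.
Qed.

Lemma mul_id_l {B : groupoid C} {X : C} {f : X ~> g1 B} {u : X ~> g0 B} :
  f · gd B = u -> mul (u · ge B) f = f.
Proof.
  intros h.
  assert (k : (u · ge B) · gc B = f · gd B)
    by (rewrite comp_assoc, ge_c, comp_id_r; auto).
  rewrite <- (gcompE k); apply gcomp_id_l.
Qed.

Lemma mul_id_r {B : groupoid C} {X : C} {f : X ~> g1 B} {u : X ~> g0 B} :
  f · gc B = u -> mul f (u · ge B) = f.
Proof.
  intros h.
  assert (k : f · gc B = (u · ge B) · gd B)
    by (rewrite comp_assoc, ge_d, comp_id_r; auto).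
  rewrite <- (gcompE k); apply gcomp_id_r.
Qed.

Lemma mul_inv_r {B : groupoid C} {X : C} (f : X ~> g1 B) :
  mul f (f · gi B) = (f · gd B) · ge B.
Proof.
  assert (h : idm (g1 B) · gc B = gi B · gd B)
    by (rewrite comp_id_l, gi_d; reflexivity).
  pose proof (gm_inv_r h) as e; fold (gcomp h) in e; rewrite gcompE in e.
  rewrite comp_assoc, <- e, (comp_mul f h), comp_id_r; reflexivity.
Qed.

Lemma mul_inv_l {B : groupoid C} {X : C} (f : X ~> g1 B) :
  mul (f · gi B) f = (f · gc B) · ge B.
Proof.
  assert (h : gi B · gc B = idm (g1 B) · gd B)
    by (rewrite comp_id_l, gi_c; reflexivity).
  pose proof (gm_inv_l h) as e; fold (gcomp h) in e; rewrite gcompE in e.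
  rewrite comp_assoc, <- e, (comp_mul f h), comp_id_r; reflexivity.
Qed.

Lemma mul_functor {A B : groupoid C} (F : functor A B) {X : C}
    {f g : X ~> g1 A} :
  f · gc A = g · gd A -> mul f g · f1 F = mul (f · f1 F) (g · f1 F).
Proof.
  intros h; rewrite <- (gcompE h), (gcomp_functor h (functor_compat F h)).
  apply gcompE.
Qed.

Lemma mul_cancel_l {B : groupoid C} {X : C} {f g : X ~> g1 B} :
  f · gc B = g · gd B -> mul (f · gi B) (mul f g) = g.
Proof.
  intros h; rewrite <- mul_assoc; trivial.
  - rewrite mul_inv_l; apply mul_id_l; auto.
  - rewrite comp_assoc, gi_c; reflexivity.
Qed.

Lemma mul_cancel_r {B : groupoid C} {X : C} {f g : X ~> g1 B} :
  f · gc B = g · gd B -> mul (mul f g) (g · gi B) = f.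
Proof.
  intros h; rewrite mul_assoc; trivial.
  - rewrite mul_inv_r; apply mul_id_r; auto.
  - rewrite comp_assoc, gi_d; reflexivity.
Qed.

(** Right inverses are unique; this gives both the preservation of inverses by
    functors and the involutivity of inversion. *)
Lemma inv_unique {B : groupoid C} {X : C} {f g : X ~> g1 B} :
  f · gc B = g · gd B -> mul f g = (f · gd B) · ge B -> g = f · gi B.
Proof.
  intros h e; rewrite <- (mul_cancel_l h), e.
  apply mul_id_r; rewrite comp_assoc, gi_c; reflexivity.
Qed.

Lemma gi_functor {A B : groupoid C} (F : functor A B) :
  gi A · f1 F = f1 F · gi B.
Proof.
  assert (h : idm (g1 A) · gc A = gi A · gd A)
    by (rewrite comp_id_l, gi_d; reflexivity).
  apply inv_unique.
  - rewrite f_c, comp_assoc, f_d, <- comp_assoc, gi_d; reflexivity.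
  - pose proof (mul_inv_r (idm (g1 A))) as e; rewrite !comp_id_l in e, h.
    rewrite <- (comp_id_l (f1 F)) at 1.
    rewrite <- mul_functor by (rewrite comp_id_l; exact h).
    rewrite e, comp_id_l, f_d, !comp_assoc, f_e; reflexivity.
Qed.

Lemma gi_gi (B : groupoid C) : gi B · gi B = idm (g1 B).
Proof.
  symmetry; apply inv_unique.
  - rewrite comp_id_l; apply gi_c.
  - pose proof (mul_inv_l (idm (g1 B))) as e; rewrite !comp_id_l in e.
    rewrite e, ?comp_id_l, gi_d; reflexivity.
Qed.

Definition mk_functor {A B : groupoid C} (u0 : g0 A ~> g0 B) (u1 : g1 A ~> g1 B)
  (hd : u1 · gd B = gd A · u0) (hc : u1 · gc B = gc A · u0)
  (he : ge A · u1 = u0 · ge B)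
  (hm : mul (gp1 A) (gp2 A) · u1 = mul (gp1 A · u1) (gp2 A · u1)) : functor A B.
Proof.
  refine (@Functor C A B u0 u1 hd hc he _).
  intros h; rewrite gcompE, gmE; exact hm.
Defined.

Definition mk_nat_trans {A B : groupoid C} (F G : functor A B)
  (a : g0 A ~> g1 B) (ad : a · gd B = f0 F) (ac : a · gc B = f0 G)
  (an : mul (gd A · a) (f1 G) = mul (f1 F) (gc A · a)) : F ==> G.
Proof.
  refine (@NatTrans C A B F G a ad ac _).
  intros h k; rewrite !gcompE; exact an.
Defined.

Lemma nt_mul {A B : groupoid C} {F G : functor A B} (a : F ==> G) :
  mul (gd A · a) (f1 G) = mul (f1 F) (gc A · a).
Proof.
  assert (h : (gd A · a) · gc B = f1 G · gd B)
    by (rewrite comp_assoc, nt_c, f_d; reflexivity).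
  assert (k : f1 F · gc B = (gc A · a) · gd B)
    by (rewrite comp_assoc, nt_d, f_c; reflexivity).
  rewrite <- (gcompE h), <- (gcompE k); apply nt_nat.
Qed.

Lemma nat_trans_invertible {A B : groupoid C} {F G : functor A B} (a : F ==> G) :
  is_invertible_cell a.
Proof.
  assert (F_ca : f1 F · gc B = (gc A · a) · gd B)
    by (rewrite comp_assoc, nt_d, f_c; reflexivity).
  assert (da_G : (gd A · a) · gc B = f1 G · gd B)
    by (rewrite comp_assoc, nt_c, f_d; reflexivity).
  unshelve eexists (@mk_nat_trans A B G F (a · gi B) _ _ _).
  - rewrite comp_assoc, gi_d; apply nt_c.
  - rewrite comp_assoc, gi_c; apply nt_d.
  - rewrite <- !comp_assoc.
    assert (di_F : gd A · a · gi B · gc B = f1 F · gd B)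
      by (rewrite !comp_assoc, gi_c, nt_d, f_d; reflexivity).
    assert (G_ci : f1 G · gc B = gc A · a · gi B · gd B)
      by (rewrite !comp_assoc, gi_d, nt_c, f_c; reflexivity).
    rewrite <- (mul_cancel_r F_ca), <- nt_mul.
    rewrite mul_assoc by assumption.
    apply mul_cancel_l.
    rewrite mul_d; assumption.
  - split; apply nat_trans_ext; simpl; rewrite gcompE; simpl.
    + rewrite mul_inv_r, nt_d; reflexivity.
    + rewrite mul_inv_l, nt_c; reflexivity.
Qed.

End Composition.

(** For equations between domains and codomains: composites are associated
    to the right and normalized by the structure equations and by every
    hypothesis that is an equation between composites. *)
Ltac bdry :=
  repeat first
    [ rewrite comp_assoc | rewrite comp_id_l | rewrite comp_id_r
    | rewrite gi_d | rewrite gi_c | rewrite gi_d_r | rewrite gi_c_r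
    | rewrite ge_d | rewrite ge_c | rewrite ge_d_r | rewrite ge_c_r
    | rewrite f_d | rewrite f_c | rewrite f_d_r | rewrite f_c_r
    | rewrite nt_d | rewrite nt_c
    | match goal with H : _ · _ = _ |- _ => rewrite H end
    | match goal with H : ?a · ?b = _ |- context [?a · (?b · ?w)] =>
        rewrite <- (comp_assoc a b w), H end ];
  try congruence.

(** * Fully faithful functors and equivalences *)

Section FullyFaithful.
Context {C : category}.

Lemma mul_cancel_common {B : groupoid C} {X : C} {f f' g : X ~> g1 B} :
  f · gc B = g · gd B -> f' · gc B = g · gd B -> mul f g = mul f' g -> f = f'.
Proof.
  intros h h' e; rewrite <- (mul_cancel_r h), e; apply mul_cancel_r; exact h'.
Qed.

Context {A B : groupoid C} {F : functor A B} (ff : is_fully_faithful F).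

Lemma ff_lift {X : C} {x z : X ~> g0 A} {y : X ~> g1 B} :
  x · f0 F = y · gd B -> y · gc B = z · f0 F ->
  exists u : X ~> g1 A, u · gd A = x /\ u · f1 F = y /\ u · gc A = z.
Proof.
  intros h k; destruct (zl_univ ff h k) as [u [Hu _]]; exists u; exact Hu.
Qed.

Lemma ff_ext {X : C} {u u' : X ~> g1 A} :
  u · gd A = u' · gd A -> u · f1 F = u' · f1 F -> u · gc A = u' · gc A -> u = u'.
Proof.
  intros hd hf hc.
  assert (h : (u' · gd A) · f0 F = (u' · f1 F) · gd B) by bdry.
  assert (k : (u' · f1 F) · gc B = (u' · gc A) · f0 F) by bdry.
  destruct (zl_univ ff h k) as [w [_ Hw]].
  transitivity w; [symmetry|]; apply Hw; auto.
Qed.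

(** The quasi-inverse sends an arrow f : b -> b' to the unique lift of
    sigma_b f sigma_b'^-1, so that sigma is natural by construction. All other
    equations between arrows of [A] are checked after applying [F], where they
    follow from the naturality of sigma. *)
Lemma equivalence_of_section (s : g0 B ~> g0 A) (sigma : g0 B ~> g1 B) :
  sigma · gd B = s · f0 F -> sigma · gc B = idm _ -> is_equivalence F.
Proof.
  intros sd sc.
  set (dom := gd B · sigma); set (cod := gc B · sigma).
  assert (h1 : dom · gc B = idm _ · gd B) by (unfold dom; bdry).
  assert (h2 : mul dom (idm _) · gc B = (cod · gi B) · gd B)
    by (rewrite (mul_c h1); unfold cod; bdry).
  destruct (@ff_lift (g1 B) (gd B · s) (gc B · s)
              (mul (mul dom (idm _)) (cod · gi B))) as [u [ud [uF uc]]].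
  { rewrite (mul_d h2), (mul_d h1); unfold dom; bdry. }
  { rewrite (mul_c h2); unfold cod; bdry; rewrite sd; reflexivity. }
  assert (hG : (u · f1 F) · gc B = cod · gd B) by (unfold cod; bdry).
  assert (nat : mul (u · f1 F) cod = mul dom (idm _)).
  { rewrite uF.
    rewrite mul_assoc, mul_inv_l by (trivial; unfold cod; bdry).
    apply mul_id_r; rewrite (mul_c h1); unfold cod; bdry. }
  assert (nat' : forall X (f : X ~> g1 B),
    mul (f · u · f1 F) (f · gc B · sigma) = mul (f · gd B · sigma) f).
  { intros X f; rewrite !comp_assoc; fold cod dom.
    rewrite <- (comp_mul f hG), nat, (comp_mul f h1), comp_id_r; reflexivity. }
  subst dom cod; clear hG uF h1 h2.
  (* Preservation of identities and composites: each is compared after [F] and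
     after composing with sigma on the right. *)
  assert (he : ge B · u = s · ge A).
  { apply ff_ext; [bdry | | bdry].
    apply (mul_cancel_common (g := sigma)); [bdry | bdry |].
    pose proof (nat' _ (ge B)) as e.
    rewrite ge_c, ge_d, !comp_id_l in e; rewrite e.
    rewrite comp_assoc, f_e, <- comp_assoc.
    rewrite (mul_id_l (u := s · f0 F)) by exact sd.
    rewrite <- (comp_id_l (ge B)); apply mul_id_r; exact sc. }
  assert (hm : mul (gp1 B) (gp2 B) · u = mul (gp1 B · u) (gp2 B · u)).
  { pose proof (pb_comm (g_pb B)) as pq.
    assert (puq : (gp1 B · u) · gc A = (gp2 B · u) · gd A) by bdry.
    apply ff_ext.
    - rewrite comp_assoc, ud, <- comp_assoc, (mul_d pq), (mul_d puq); bdry.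
    - apply (mul_cancel_common (g := (gp2 B · gc B · sigma))).
      + rewrite comp_assoc, f_c, comp_assoc, <- (comp_assoc u), uc.
        rewrite comp_assoc, <- comp_assoc, (mul_c pq); bdry.
      + rewrite comp_assoc, f_c, <- comp_assoc, (mul_c puq); bdry.
      + rewrite <- (mul_c pq), nat', (mul_d pq), (mul_c pq).
        rewrite (mul_functor F puq).
        rewrite mul_assoc by bdry.
        rewrite nat', <- pq, <- (mul_assoc (f := gp1 B · u · f1 F)) by bdry.
        rewrite nat', mul_assoc by bdry.
        reflexivity.
    - rewrite comp_assoc, uc, <- comp_assoc, (mul_c pq), (mul_c puq); bdry. }
  pose (G := mk_functor ud uc he hm).
  (* The 2-cell from [F ⊙ G] to the identity lifts sigma at the objects
     [F x]. *)
  destruct (@ff_lift (g0 A) (f0 F · s) (idm _) (f0 F · sigma))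
    as [a [ad [aF ac]]].
  { bdry. }
  { bdry. }
  unshelve eexists G, (@mk_nat_trans C A A _ _ a _ _ _),
    (@mk_nat_trans C B B _ _ sigma _ _ _); simpl; try assumption.
  - assert (k : (gd A · a) · gc A = idm _ · gd A) by bdry.
    assert (k' : (f1 F · u) · gc A = (gc A · a) · gd A) by bdry.
    apply ff_ext.
    + rewrite (mul_d k), (mul_d k'); bdry.
    + rewrite (mul_functor F k), (mul_functor F k'), comp_id_l.
      rewrite !comp_assoc, aF, <- !comp_assoc, <- f_d, <- f_c.
      symmetry; apply nat'.
    + rewrite (mul_c k), (mul_c k'); bdry.
  - symmetry; exact nat.
  - split; apply nat_trans_invertible.
Qed.

Lemma equivalence_iff_split {P : C} {ad : P ~> g0 A} {bd : P ~> g1 B} :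
  is_pullback (f0 F) (gd B) ad bd ->
  is_equivalence F <-> is_split_epi (bd · gc B).
Proof.
  intros pb; split.
  - intros [G [_ [b _]]].
    assert (h : f0 G · f0 F = b · gd B) by (rewrite nt_d; reflexivity).
    exists (pb_pair pb h); rewrite <- comp_assoc, pair_snd, nt_c; reflexivity.
  - intros [s hs]; apply (@equivalence_of_section (s · ad) (s · bd)).
    + rewrite !comp_assoc, (pb_comm pb); reflexivity.
    + rewrite comp_assoc; exact hs.
Qed.

End FullyFaithful.

(** * Invariance under isomorphism *)

Section Isomorphisms.
Context {C : category}.

Definition is_iso {X Y : C} (i : X ~> Y) : Prop :=
  exists j : Y ~> X, i · j = idm X /\ j · i = idm Y.

Lemma id_is_iso (X : C) : is_iso (idm X).
Proof. exists (idm X); split; apply comp_id_l. Qed.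

Definition iso_invariant (Phi : forall X Y : C, (X ~> Y) -> Prop) : Prop :=
  forall (X X' Y Y' : C) (i : X ~> X') (f : X' ~> Y) (j : Y ~> Y'),
    is_iso i -> is_iso j -> Phi _ _ f -> Phi _ _ (i · f · j).

Lemma regular_epi_iso_invariant : iso_invariant (@is_regular_epi C).
Proof.
  intros X X' Y Y' i f j [i' [ii' i'i]] [j' [jj' j'j]] [W [u [v [e univ]]]].
  exists W, (u · i'), (v · i'); split.
  - rewrite <- !comp_assoc, !(comp_assoc _ i' i), i'i, !comp_id_r, e.
    reflexivity.
  - intros Z g hg.
    destruct (univ Z (i' · g)) as [h [fh hu]].
    { rewrite <- !comp_assoc; exact hg. }
    exists (j' · h); split.
    + rewrite !comp_assoc, <- (comp_assoc j), jj', comp_id_l, fh.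
      rewrite <- comp_assoc, ii'; apply comp_id_l.
    + intros k hk; rewrite (hu (j · k)).
      * rewrite <- comp_assoc, j'j; apply comp_id_l.
      * rewrite <- hk, <- !comp_assoc, i'i, comp_id_l; reflexivity.
Qed.

Lemma split_epi_iso_invariant : iso_invariant (@is_split_epi C).
Proof.
  intros X X' Y Y' i f j [i' [ii' i'i]] [j' [jj' j'j]] [s hs].
  exists (j' · s · i').
  rewrite !comp_assoc, <- (comp_assoc i'), i'i, comp_id_l.
  rewrite <- (comp_assoc s), hs, comp_id_l; exact j'j.
Qed.

Lemma pullback_unique {A B D P P' : C} {f : A ~> D} {g : B ~> D}
    {p : P ~> A} {q : P ~> B} {p' : P' ~> A} {q' : P' ~> B} :
  is_pullback f g p q -> is_pullback f g p' q' ->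
  exists i : P ~> P', is_iso i /\ i · p' = p /\ i · q' = q.
Proof.
  intros pb pb'.
  destruct (pb_univ pb' (pb_comm pb)) as [i [[ip iq] _]].
  destruct (pb_univ pb (pb_comm pb')) as [j [[jp jq] _]].
  exists i; split; [exists j; split|auto].
  - apply (pullback_ext pb); rewrite comp_assoc, comp_id_l; congruence.
  - apply (pullback_ext pb'); rewrite comp_assoc, comp_id_l; congruence.
Qed.

Lemma pullback_iso {A B D P P' : C} {f : A ~> D} {g : B ~> D}
    {p : P ~> A} {q : P ~> B} {p' : P' ~> A} {q' : P' ~> B} {i : P ~> P'} :
  is_iso i -> i · p' = p -> i · q' = q ->
  is_pullback f g p' q' -> is_pullback f g p q.
Proof.
  intros [j [ij ji]] ip iq pb; split.
  - rewrite <- ip, <- iq, !comp_assoc, (pb_comm pb); reflexivity.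
  - intros X x y h; destruct (pb_univ pb h) as [u [[up uq] hu]].
    exists (u · j); split.
    + split; [rewrite <- ip, <- up | rewrite <- iq, <- uq];
        rewrite comp_assoc, <- (comp_assoc j), ji, comp_id_l; reflexivity.
    + intros w [wp wq]; rewrite (hu (w · i)).
      * rewrite comp_assoc, ij; apply comp_id_r.
      * rewrite !comp_assoc, ip, iq; auto.
Qed.

End Isomorphisms.

(** * Pullbacks of internal groupoids are levelwise *)

Section LevelwisePullbacks.
Context {C : category}.

Lemma f0_eq {A B : groupoid C} {F G : functor A B} : F = G -> f0 F = f0 G.
Proof. intros e; rewrite e; reflexivity. Qed.

Lemma f1_eq {A B : groupoid C} {F G : functor A B} : F = G -> f1 F = f1 G.
Proof. intros e; rewrite e; reflexivity. Qed.

Lemma pb_lift {A B D P : C} {f : A ~> D} {g : B ~> D} {p : P ~> A} {q : P ~> B}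
    (pb : is_pullback f g p q) {X : C} {x : X ~> A} {y : X ~> B} :
  x · f = y · g -> exists u : X ~> P, u · p = x /\ u · q = y.
Proof. intros h; destruct (pb_univ pb h) as [u [Hu _]]; exists u; exact Hu. Qed.

(** The structure maps are induced by those of [A] and [D], and every law holds
    because it holds after each of the two projections. *)
Lemma levelwise_pullback_exists
    (pullbacks : forall (A B D : C) (f : A ~> D) (g : B ~> D),
      exists (P : C) (p : P ~> A) (q : P ~> B), is_pullback f g p q)
    {A B D : groupoid C} (F : functor A B) (G : functor D B) :
  exists (P : groupoid C) (p : functor P A) (q : functor P D),
    is_pullback (f0 F) (f0 G) (f0 p) (f0 q) /\
    is_pullback (f1 F) (f1 G) (f1 p) (f1 q).
Proof.
  destruct (pullbacks _ _ _ (f0 F) (f0 G)) as [P0 [p0 [q0 pb0]]].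
  destruct (pullbacks _ _ _ (f1 F) (f1 G)) as [P1 [p1 [q1 pb1]]].
  pose proof (pb_comm pb0) as e0; pose proof (pb_comm pb1) as e1.
  destruct (@pb_lift _ _ _ _ _ _ _ _ pb0 P1 (p1 · gd A) (q1 · gd D))
    as [d [dp dq]].
  { rewrite !comp_assoc, <- !f_d, <- !comp_assoc, e1; reflexivity. }
  destruct (@pb_lift _ _ _ _ _ _ _ _ pb0 P1 (p1 · gc A) (q1 · gc D))
    as [c [cp cq]].
  { rewrite !comp_assoc, <- !f_c, <- !comp_assoc, e1; reflexivity. }
  destruct (@pb_lift _ _ _ _ _ _ _ _ pb1 P0 (p0 · ge A) (q0 · ge D))
    as [e [ep eq]].
  { rewrite !comp_assoc, !f_e, <- !comp_assoc, e0; reflexivity. }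
  destruct (@pb_lift _ _ _ _ _ _ _ _ pb1 P1 (p1 · gi A) (q1 · gi D))
    as [i [ip iq]].
  { rewrite !comp_assoc, !gi_functor, <- !comp_assoc, e1; reflexivity. }
  destruct (pullbacks _ _ _ c d) as [P2 [r1 [r2 pb2]]].
  assert (compP : forall X (x y : X ~> P1), x · c = y · d ->
    (x · p1) · gc A = (y · p1) · gd A).
  { intros X x y h; rewrite !comp_assoc, <- cp, <- dp, <- !comp_assoc, h.
    reflexivity. }
  assert (compQ : forall X (x y : X ~> P1), x · c = y · d ->
    (x · q1) · gc D = (y · q1) · gd D).
  { intros X x y h; rewrite !comp_assoc, <- cq, <- dq, <- !comp_assoc, h.
    reflexivity. }
  pose proof (compP _ _ _ (pb_comm pb2)) as rp.
  pose proof (compQ _ _ _ (pb_comm pb2)) as rq.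
  destruct (@pb_lift _ _ _ _ _ _ _ _ pb1 P2
    (mul (r1 · p1) (r2 · p1)) (mul (r1 · q1) (r2 · q1))) as [m [mp mq]].
  { rewrite (mul_functor F rp), (mul_functor G rq), !comp_assoc, e1.
    reflexivity. }
  assert (pairP : forall X (x y : X ~> P1) (h : x · c = y · d),
    (pb_pair pb2 h · m) · p1 = mul (x · p1) (y · p1)).
  { intros; rewrite comp_assoc, mp, (comp_mul _ rp), <- !comp_assoc.
    rewrite pair_fst, pair_snd; reflexivity. }
  assert (pairQ : forall X (x y : X ~> P1) (h : x · c = y · d),
    (pb_pair pb2 h · m) · q1 = mul (x · q1) (y · q1)).
  { intros; rewrite comp_assoc, mq, (comp_mul _ rq), <- !comp_assoc.
    rewrite pair_fst, pair_snd; reflexivity. }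
  unshelve refine (let R := @Groupoid C P0 P1 P2 d c e r1 r2 pb2 m i
    _ _ _ _ _ _ _ _ _ _ _ in _).
  - apply (pullback_ext pb0); bdry.
  - apply (pullback_ext pb0); bdry.
  - apply (pullback_ext pb0); rewrite !comp_assoc, ?dp, ?dq, <- !comp_assoc;
      rewrite ?mp, ?mq; [apply (mul_d rp) | apply (mul_d rq)].
  - apply (pullback_ext pb0); rewrite !comp_assoc, ?cp, ?cq, <- !comp_assoc;
      rewrite ?mp, ?mq; [apply (mul_c rp) | apply (mul_c rq)].
  - apply (pullback_ext pb0); bdry.
  - apply (pullback_ext pb0); bdry.
  - intros h; apply (pullback_ext pb1); rewrite ?pairP, ?pairQ.
    + rewrite comp_assoc, ep, <- comp_assoc, dp, comp_id_l.
      apply mul_id_l; reflexivity.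
    + rewrite comp_assoc, eq, <- comp_assoc, dq, comp_id_l.
      apply mul_id_l; reflexivity.
  - intros h; apply (pullback_ext pb1); rewrite ?pairP, ?pairQ.
    + rewrite comp_assoc, ep, <- comp_assoc, cp, comp_id_l.
      apply mul_id_r; reflexivity.
    + rewrite comp_assoc, eq, <- comp_assoc, cq, comp_id_l.
      apply mul_id_r; reflexivity.
  - intros X f g h fg gh fg_h f_gh; apply (pullback_ext pb1).
    + rewrite !pairP; apply mul_assoc; apply compP; assumption.
    + rewrite !pairQ; apply mul_assoc; apply compQ; assumption.
  - intros h; apply (pullback_ext pb1); rewrite ?pairP, ?pairQ.
    + rewrite ip, comp_id_l, mul_inv_r; bdry.
    + rewrite iq, comp_id_l, mul_inv_r; bdry.
  - intros h; apply (pullback_ext pb1); rewrite ?pairP, ?pairQ.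
    + rewrite ip, comp_id_l, mul_inv_l; bdry.
    + rewrite iq, comp_id_l, mul_inv_l; bdry.
  - unshelve eexists R, (@mk_functor C R A p0 p1 _ _ _ _),
      (@mk_functor C R D q0 q1 _ _ _ _); simpl; auto.
    + change (mul (gp1 R) (gp2 R) · p1 = mul (r1 · p1) (r2 · p1)).
      rewrite <- (gmE R); exact mp.
    + change (mul (gp1 R) (gp2 R) · q1 = mul (r1 · q1) (r2 · q1)).
      rewrite <- (gmE R); exact mq.
Qed.

Lemma levelwise_is_pullback {A B D P : groupoid C}
    {F : functor A B} {G : functor D B} {p : functor P A} {q : functor P D} :
  is_pullback (f0 F) (f0 G) (f0 p) (f0 q) ->
  is_pullback (f1 F) (f1 G) (f1 p) (f1 q) ->
  @is_pullback (Grpd C) _ _ _ _ F G p q.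
Proof.
  intros pb0 pb1; split.
  - apply functor_ext; simpl; [apply (pb_comm pb0) | apply (pb_comm pb1)].
  - intros X H K HK; simpl in *.
    destruct (pb_lift pb0 (f0_eq HK)) as [u0 [u0p u0q]].
    destruct (pb_lift pb1 (f1_eq HK)) as [u1 [u1p u1q]].
    assert (ud : u1 · gd P = gd X · u0).
    { apply (pullback_ext pb0); rewrite !comp_assoc, <- f_d, <- (comp_assoc u1);
        [rewrite u1p, u0p | rewrite u1q, u0q]; apply f_d. }
    assert (uc : u1 · gc P = gc X · u0).
    { apply (pullback_ext pb0); rewrite !comp_assoc, <- f_c, <- (comp_assoc u1);
        [rewrite u1p, u0p | rewrite u1q, u0q]; apply f_c. }
    assert (ue : ge X · u1 = u0 · ge P).
    { apply (pullback_ext pb1); rewrite !comp_assoc, f_e, <- (comp_assoc u0);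
        [rewrite u1p, u0p | rewrite u1q, u0q]; apply f_e. }
    pose proof (pb_comm (g_pb X)) as pX.
    assert (um : mul (gp1 X) (gp2 X) · u1 = mul (gp1 X · u1) (gp2 X · u1)).
    { assert (h : (gp1 X · u1) · gc P = (gp2 X · u1) · gd P) by bdry.
      apply (pullback_ext pb1); rewrite (mul_functor _ h), !comp_assoc;
        [rewrite u1p | rewrite u1q]; apply (mul_functor _ pX). }
    exists (mk_functor ud uc ue um); split.
    + split; apply functor_ext; assumption.
    + intros U [Up Uq]; subst H K; apply functor_ext; simpl in *.
      * apply (pullback_ext pb0); congruence.
      * apply (pullback_ext pb1); congruence.
Qed.

(** Any pullback is isomorphic to the one computed levelwise. This detour is
    needed for arrows: a groupoid representing generalized arrows X -> [g1 P]
    would be [discrete X] times the free isomorphism, and building it takes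
    coproducts in [C]. *)
Lemma pullback_levelwise
    (pullbacks : forall (A B D : C) (f : A ~> D) (g : B ~> D),
      exists (P : C) (p : P ~> A) (q : P ~> B), is_pullback f g p q)
    {A B D P : groupoid C}
    {F : functor A B} {G : functor D B} {p : functor P A} {q : functor P D} :
  @is_pullback (Grpd C) _ _ _ _ F G p q ->
  is_pullback (f0 F) (f0 G) (f0 p) (f0 q) /\
  is_pullback (f1 F) (f1 G) (f1 p) (f1 q).
Proof.
  intros pb.
  destruct (levelwise_pullback_exists pullbacks F G) as [R [r [s [pb0 pb1]]]].
  destruct (pullback_unique pb (levelwise_is_pullback pb0 pb1))
    as [i [[j [ij ji]] [ir is_]]]; simpl in *.
  split.
  - apply (pullback_iso (i := f0 i) (p' := f0 r) (q' := f0 s));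
      [|exact (f0_eq ir) | exact (f0_eq is_) | exact pb0].
    exists (f0 j); split; [exact (f0_eq ij) | exact (f0_eq ji)].
  - apply (pullback_iso (i := f1 i) (p' := f1 r) (q' := f1 s));
      [|exact (f1_eq ir) | exact (f1_eq is_) | exact pb1].
    exists (f1 j); split; [exact (f1_eq ij) | exact (f1_eq ji)].
Qed.

End LevelwisePullbacks.

(** * Discrete groupoids as test objects *)

Section Discrete.
Context {C : category}.

Definition discrete_functor {X : C} {A : groupoid C} (x : X ~> g0 A) :
  functor (discrete X) A.
Proof.
  unshelve refine (@mk_functor C (discrete X) A x (x · ge A) _ _ _ _); simpl.
  - rewrite comp_assoc, ge_d, comp_id_l; apply comp_id_r.
  - rewrite comp_assoc, ge_c, comp_id_l; apply comp_id_r.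
  - apply comp_id_l.
  - rewrite !comp_id_l, mul_id_r.
    + change (mul (gp1 (discrete X)) (gp2 (discrete X)) · (x · ge A) = x · ge A).
      rewrite <- gmE; apply comp_id_l.
    + rewrite comp_assoc, ge_c; apply comp_id_r.
Defined.

Lemma discrete_f1 {X : C} {A : groupoid C} (L : functor (discrete X) A) :
  f1 L = f0 L · ge A.
Proof. rewrite <- f_e; symmetry; apply comp_id_l. Qed.

Lemma discrete_functor_ext {X : C} {A : groupoid C}
    (L M : functor (discrete X) A) : f0 L = f0 M -> L = M.
Proof.
  intros h; apply functor_ext; [exact h|]; rewrite !discrete_f1, h; reflexivity.
Qed.

Definition discrete_cell {X : C} {A : groupoid C} (L M : functor (discrete X) A)
    (a : X ~> g1 A) (ad : a · gd A = f0 L) (ac : a · gc A = f0 M) : L ==> M.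
Proof.
  refine (@mk_nat_trans C (discrete X) A L M a ad ac _); simpl.
  rewrite comp_id_l, !discrete_f1.
  transitivity a; [exact (mul_id_r ac) | symmetry; exact (mul_id_l ad)].
Defined.

Lemma into_discrete {X : C} {A : groupoid C} (L : functor A (discrete X)) :
  f1 L = gd A · f0 L.
Proof. rewrite <- f_d; symmetry; apply comp_id_r. Qed.

Lemma into_discrete_c {X : C} {A : groupoid C} (L : functor A (discrete X)) :
  f1 L = gc A · f0 L.
Proof. rewrite <- f_c; symmetry; apply comp_id_r. Qed.

End Discrete.

(** * The strong h-pullback of a functor along the embedding of objects *)

Section HomotopyPullback.
Context {C : category} {A B V : groupoid C} {F : functor A B}.
Context {F' : functor V (discrete (g0 B))} {N' : functor V A}.
Context {v : nat_trans (fcomp F' (discrete_incl B)) (fcomp N' F)}.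
Context (shpV : is_strong_h_pullback (F := F) (G := discrete_incl B)
                  (G' := N') (F' := F') v).

Lemma v_d : v · gd B = f0 F'.
Proof. rewrite nt_d; apply comp_id_r. Qed.

Lemma v_c : v · gc B = f0 N' · f0 F.
Proof. apply nt_c. Qed.

(** An object of the strong h-pullback is an object x of [A] with an arrow into
    [F x]; its component in [B_0] is the domain of that arrow. *)
Lemma shp_objects : is_pullback (f0 F) (gc B) (f0 N') v.
Proof.
  split; [symmetry; apply v_c|].
  intros X x b h.
  set (H := discrete_functor x).
  set (K := @discrete_functor C X (discrete (g0 B)) (b · gd B)).
  unshelve epose (mu := @discrete_cell C X B
    (K ⊙ discrete_incl B) (H ⊙ F) b _ _).
  { symmetry; apply comp_id_r. }
  { symmetry; exact h. }
  destruct (shp_functor shpV mu) as [T [[TN [TF Tv]] Tu]].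
  exists (f0 T); split; [split|].
  - exact (f0_eq TN).
  - exact Tv.
  - intros u [uN uv].
    apply (f0_eq (G := discrete_functor u)), Tu; repeat split.
    + apply discrete_functor_ext; exact uN.
    + apply discrete_functor_ext; simpl.
      rewrite <- v_d, <- comp_assoc, uv; reflexivity.
    + exact uv.
Qed.

(** The component of an arrow in the discrete groupoid [B_0] is an identity, so
    the condition on 2-cells says that the two legs into [F] differ by [F b]. *)
Lemma shp_arrows {X : C} {l m : X ~> g0 V} {b : X ~> g1 A} :
  b · gd A = l · f0 N' -> b · gc A = m · f0 N' ->
  l · f0 F' = m · f0 F' ->
  mul (l · v) (b · f1 F) = m · v ->
  exists! u : X ~> g1 V, u · gd V = l /\ u · gc V = m /\ u · f1 N' = b.
Proof.
  intros bd bc lm nat.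
  set (L := discrete_functor l).
  set (M := discrete_functor m).
  unshelve epose (alpha := @discrete_cell C X _ (L ⊙ F') (M ⊙ F')
    (l · f0 F') _ _).
  { apply comp_id_r. }
  { simpl; rewrite comp_id_r; exact lm. }
  pose (beta := @discrete_cell C X _ (L ⊙ N') (M ⊙ N') b bd bc).
  destruct (shp_cell shpV (L := L) (M := M) (a := alpha) (b := beta))
    as [mu [[ma mb] mu_unique]].
  { apply nat_trans_ext; simpl; rewrite !gcompE; simpl.
    rewrite nat; symmetry; apply mul_id_l.
    rewrite comp_assoc, v_d; symmetry; exact lm. }
  exists mu; repeat split.
  - exact (nt_d mu).
  - exact (nt_c mu).
  - exact (f_equal (@nt _ _ _ _ _) mb).
  - intros u [ud [uc uN]].
    pose (nu := @discrete_cell C X V L M u ud uc).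
    assert (e : mu = nu).
    { apply mu_unique; split; apply nat_trans_ext; simpl.
      - rewrite into_discrete, <- comp_assoc, ud; reflexivity.
      - exact uN. }
    rewrite e; reflexivity.
Qed.

(** Inverting the arrow part of an object exchanges the roles of [gc B] and
    [gd B]. This is how the pullback of [f0 F] and [gd B], the target of tau_d,
    appears as the object of objects of the strong h-pullback. *)
Lemma shp_objects_d : is_pullback (f0 F) (gd B) (f0 N') (v · gi B).
Proof.
  split.
  - rewrite comp_assoc, gi_d; symmetry; apply v_c.
  - intros X x b h.
    assert (h' : x · f0 F = (b · gi B) · gc B)
      by (rewrite comp_assoc, gi_c; exact h).
    destruct (pb_univ shp_objects h') as [u [[uN uv] hu]].
    exists u; split; [split|].
    + exact uN.
    + rewrite <- comp_assoc, uv, comp_assoc, gi_gi; apply comp_id_r.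
    + intros w [wN wv]; apply hu; split; [exact wN|].
      rewrite <- wv, !comp_assoc, gi_gi, comp_id_r; reflexivity.
Qed.

(** Naturality of [v], whose second side is simply the arrow part of the target
    because the component in the discrete groupoid is an identity. *)
Lemma v_mul {X : C} (y : X ~> g1 V) :
  mul (y · gd V · v) (y · f1 N' · f1 F) = y · gc V · v.
Proof.
  assert (h : (gd V · v) · gc B = (f1 N' · f1 F) · gd B)
    by (rewrite comp_assoc, v_c; bdry).
  rewrite !comp_assoc, <- (comp_mul y h).
  f_equal; rewrite (nt_mul v : mul _ (f1 N' · f1 F) = _); simpl.
  rewrite into_discrete_c; apply (@mul_id_l C B _ (gc V · v)).
  rewrite comp_assoc, v_d; reflexivity.
Qed.

Lemma shp_arrows_ext {X : C} {u u' : X ~> g1 V} :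
  u · gd V = u' · gd V -> u · gc V = u' · gc V -> u · f1 N' = u' · f1 N' ->
  u = u'.
Proof.
  intros hd hc hN.
  destruct (@shp_arrows X (u' · gd V) (u' · gc V) (u' · f1 N')) as [w [_ Hw]].
  - bdry.
  - bdry.
  - rewrite !comp_assoc, <- into_discrete, <- into_discrete_c; reflexivity.
  - apply v_mul.
  - transitivity w; [symmetry|]; apply Hw; auto.
Qed.

End HomotopyPullback.

(** * The comparison functor *)

Section Comparison.
Context {C : category} {A B V : groupoid C} {F : functor A B}.
Context {F' : functor V (discrete (g0 B))} {N' : functor V A}.
Context {v : nat_trans (fcomp F' (discrete_incl B)) (fcomp N' F)}.
Context (shpV : is_strong_h_pullback (F := F) (G := discrete_incl B)
                  (G' := N') (F' := F') v).
Context {Q : groupoid C} {Fhat : functor Q (discrete (g0 B))} {Nhat : functor Q A}.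
Context (pbQ0 : is_pullback (f0 (discrete_incl B)) (f0 F) (f0 Fhat) (f0 Nhat)).
Context (pbQ1 : is_pullback (f1 (discrete_incl B)) (f1 F) (f1 Fhat) (f1 Nhat)).
Context {T : functor Q V}.
Context (T_F' : fcomp T F' = Fhat) (T_N' : fcomp T N' = Nhat).
Context (T_v : cell_eq (whisker_l T v) (id_cell (fcomp Fhat (discrete_incl B)))).

Lemma comparison_unit : f0 T · v = (f0 Fhat : g0 Q ~> g0 B) · ge B.
Proof.
  exact (eq_trans T_v (f_equal (fun w => w · ge B) (comp_id_r (f0 Fhat)))).
Qed.

(** [f0 (discrete_incl B)] is an identity, so [f0 Nhat], its parallel side in
    the pullback square, is invertible: this lemma and the next one say that it
    is monic and surjective on generalized elements. *)
Lemma kernel_objects_ext {X : C} {x x' : X ~> g0 Q} :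
  x · f0 Nhat = x' · f0 Nhat -> x = x'.
Proof.
  intros h; apply (pullback_ext pbQ0); [|exact h].
  pose proof (pb_comm pbQ0) as e; simpl in e; rewrite comp_id_r in e.
  rewrite e, <- !comp_assoc, h; reflexivity.
Qed.

Lemma kernel_objects_lift {X : C} (a : X ~> g0 A) :
  exists x : X ~> g0 Q, x · f0 Nhat = a.
Proof.
  destruct (@pb_lift _ _ _ _ _ _ _ _ _ pbQ0 X (a · f0 F) a) as [x [_ hx]].
  - apply comp_id_r.
  - exists x; exact hx.
Qed.

(** The arrow part of [T x] is an identity, so that of the target of an arrow
    out of [T x] is the image under [F] of the component in [A]. *)
Lemma arrow_from_kernel {X : C} {x : X ~> g0 Q} {y : X ~> g1 V} :
  x · f0 T = y · gd V -> y · f1 N' · f1 F = y · gc V · v.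
Proof.
  intros h; rewrite <- (v_mul (v := v)), <- h, (comp_assoc x), comparison_unit.
  rewrite <- comp_assoc.
  symmetry.
  apply (@mul_id_l C B X (y · f1 N' · f1 F) (x · (f0 Fhat : g0 Q ~> g0 B))).
  rewrite !comp_assoc, f_d, f_d_r, <- (comp_assoc y), <- h.
  rewrite <- (v_c (v := v)), comp_assoc, <- (comp_assoc (f0 T)), comparison_unit; bdry.
Qed.

(** An arrow of the strong h-pullback between two objects in the image of [T]
    has an identity as the [F]-image of its component in [A], and that component
    determines the arrow. *)
Lemma comparison_fully_faithful : is_fully_faithful T.
Proof.
  assert (TF0 : f0 T · f0 F' = f0 Fhat) by exact (f0_eq T_F').
  assert (TF1 : f1 T · f1 F' = f1 Fhat) by exact (f1_eq T_F').
  assert (TN0 : f0 T · f0 N' = f0 Nhat) by exact (f0_eq T_N').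
  assert (TN1 : f1 T · f1 N' = f1 Nhat) by exact (f1_eq T_N').
  split; [symmetry; apply f_d | apply f_c |].
  intros X x y z xy yz.
  assert (h : (y · f1 F') · ge B = (y · f1 N') · f1 F).
  { rewrite (arrow_from_kernel xy), yz, (comp_assoc z), comparison_unit, <- TF0.
    rewrite into_discrete_c, <- !comp_assoc, <- yz; reflexivity. }
  destruct (pb_lift pbQ1 h) as [u [uF uN]].
  assert (ud : u · gd Q = x).
  { apply kernel_objects_ext.
    rewrite comp_assoc, <- f_d, <- comp_assoc, uN, comp_assoc, f_d.
    rewrite <- comp_assoc, <- xy, comp_assoc, TN0; reflexivity. }
  assert (uc : u · gc Q = z).
  { apply kernel_objects_ext.
    rewrite comp_assoc, <- f_c, <- comp_assoc, uN, comp_assoc, f_c.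
    rewrite <- comp_assoc, yz, comp_assoc, TN0; reflexivity. }
  exists u; split; [split; [exact ud | split; [|exact uc]]|].
  - apply (shp_arrows_ext shpV); rewrite comp_assoc.
    + rewrite f_d, <- comp_assoc, ud; exact xy.
    + rewrite f_c, <- comp_assoc, uc; symmetry; exact yz.
    + rewrite TN1; exact uN.
  - intros w [_ [wT _]]; apply (pullback_ext pbQ1).
    + rewrite uF, <- wT, comp_assoc, TF1; reflexivity.
    + rewrite uN, <- wT, comp_assoc, TN1; reflexivity.
Qed.

(** An arrow out of [T x] amounts to an arrow of [A] out of x, and [t] is the
    arrow tau_c that computes its target. *)
Lemma comparison_objects {t : g1 A ~> g0 V} :
  t · f0 N' = gc A -> t · v = f1 F ->
  exists (ad : g1 A ~> g0 Q) (bd : g1 A ~> g1 V),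
    is_pullback (f0 T) (gd V) ad bd /\ bd · gc V = t.
Proof.
  intros tN tv.
  assert (TF0 : f0 T · f0 F' = f0 Fhat) by exact (f0_eq T_F').
  assert (TN0 : f0 T · f0 N' = f0 Nhat) by exact (f0_eq T_N').
  pose proof (pb_comm pbQ0) as QF; simpl in QF; rewrite comp_id_r in QF.
  destruct (kernel_objects_lift (gd A)) as [ad adN].
  assert (adF : ad · f0 Fhat = gd A · f0 F) 
    by (rewrite QF, <- comp_assoc, adN; reflexivity).
  destruct (@shp_arrows _ _ _ _ _ _ _ _ shpV _ (ad · f0 T) t (idm _))
    as [bd [[bdd [bdc bdN]] _]].
  - rewrite comp_assoc, TN0, adN; apply comp_id_l.
  - rewrite tN; apply comp_id_l.
  - rewrite comp_assoc, TF0, adF, <- (v_d (v := v)), <- (comp_assoc t), tv.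
    symmetry; exact (f_d F).
  - rewrite comp_assoc, comparison_unit, <- comp_assoc, tv, comp_id_l.
    apply mul_id_l; rewrite f_d; symmetry; exact adF.
  - exists ad, bd; split; [split|exact bdc].
    + symmetry; exact bdd.
    + intros X x y h.
      assert (hx : y · f1 N' · ad = x).
      { apply kernel_objects_ext.
        rewrite comp_assoc, adN, comp_assoc, f_d, <- comp_assoc, <- h.
        rewrite comp_assoc, TN0; reflexivity. }
      exists (y · f1 N'); split; [split; [exact hx|]|].
      * apply (shp_arrows_ext shpV); rewrite comp_assoc.
        -- rewrite bdd, <- comp_assoc, hx; exact h.
        -- rewrite bdc; apply (pullback_ext (shp_objects shpV)).
           ++ bdry.
           ++ rewrite (comp_assoc _ t), tv; exact (arrow_from_kernel h).
        -- rewrite bdN; apply comp_id_r.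
      * intros w [_ wb].
        rewrite <- wb, comp_assoc, bdN; apply comp_id_r.
Qed.

(** Both sides are equivalent to [Phi] of tau_c: the left one because tau_d is
    tau_c preceded by inversion in [A], once the pullback of [f0 F] and [gd B] is
    taken to be [g0 V] through inversion in [B]; the right one by
    [comparison_objects]. *)
Lemma fibration_iff_surjective (Phi : forall X Y : C, (X ~> Y) -> Prop) :
  iso_invariant Phi ->
  (exists (P : C) (ad : P ~> g0 A) (bd : P ~> g1 B)
     (pb : is_pullback (f0 F) (gd B) ad bd), Phi _ _ (pb_pair pb (tau_compat F)))
  <->
  (exists (P : C) (ad : P ~> g0 Q) (bd : P ~> g1 V),
     is_pullback (f0 T) (gd V) ad bd /\ Phi _ _ (bd · gc V)).
Proof.
  intros inv.
  assert (tau_c_compat : gc A · f0 F = f1 F · gc B)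
    by (symmetry; apply f_c).
  destruct (pb_lift (shp_objects shpV) tau_c_compat) as [t [tN tv]].
  pose proof (shp_objects_d shpV) as pbd.
  assert (gi_iso : is_iso (gi A)) by (exists (gi A); split; apply gi_gi).
  assert (tau_N : (gi A · t) · f0 N' = gd A) by bdry.
  assert (tau_v : (gi A · t) · (v · gi B) = f1 F).
  { rewrite comp_assoc, <- (comp_assoc t), tv, <- comp_assoc, gi_functor.
    rewrite comp_assoc, gi_gi; apply comp_id_r. }
  transitivity (Phi _ _ t).
  - split.
    + intros [P [ad [bd [pb H]]]].
      destruct (pullback_unique pb pbd) as [j [jiso [jN jv]]].
      assert (e : gi A · pb_pair pb (tau_compat F) · j = t).
      { assert (e' : pb_pair pb (tau_compat F) · j = gi A · t).
        { apply (pullback_ext pbd);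
            rewrite comp_assoc, ?jN, ?jv, ?pair_fst, ?pair_snd; auto. }
        rewrite comp_assoc, e', <- comp_assoc, gi_gi; apply comp_id_l. }
      rewrite <- e; apply inv; assumption.
    + intros H; exists _, _, _, pbd.
      replace (pb_pair pbd (tau_compat F)) with (gi A · t · idm _).
      * apply inv; [exact gi_iso | apply id_is_iso | exact H].
      * rewrite comp_id_r; apply (pullback_ext pbd);
          rewrite ?pair_fst, ?pair_snd; assumption.
  - destruct (comparison_objects tN tv) as [ad [bd [pb bdc]]].
    split.
    + intros H; exists _, ad, bd; rewrite bdc; auto.
    + intros [P [ad' [bd' [pb' H]]]].
      destruct (pullback_unique pb pb') as [j [jiso [_ jb]]].
      rewrite <- bdc, <- jb, comp_assoc, <- (comp_id_r (bd' · gc V)), <- comp_assoc.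
      apply inv; [exact jiso | apply id_is_iso | exact H].
Qed.

End Comparison.

Theorem proposition3p2 (C : category) (regC : is_regular_category C)
  (A B : groupoid C) (F : functor A B)
  (* the pullback of N and F in the category of internal groupoids *)
  (Q : groupoid C) (Fhat : functor Q (discrete (g0 B))) (Nhat : functor Q A)
  (pbQ : @is_pullback (Grpd C) _ _ _ _ (discrete_incl B) F Fhat Nhat)
  (* the strong h-pullback of F and N *)
  (V : groupoid C) (F' : functor V (discrete (g0 B))) (N' : functor V A)
  (v : nat_trans (fcomp F' (discrete_incl B)) (fcomp N' F))
  (shpV : is_strong_h_pullback (F := F) (G := discrete_incl B)
            (G' := N') (F' := F') v)
  (* the comparison functor *)
  (T : functor Q V)
  (T_F' : fcomp T F' = Fhat)
  (T_N' : fcomp T N' = Nhat)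
  (T_v : cell_eq (whisker_l T v) (id_cell (fcomp Fhat (discrete_incl B)))) :
  (is_fibration F <-> is_weak_equivalence T) /\
  (is_split_epi_fibration F <-> is_equivalence T).
Proof.
  destruct (pullback_levelwise (reg_pullback regC) pbQ) as [pbQ0 pbQ1].
  pose proof (comparison_fully_faithful shpV pbQ0 pbQ1 T_F' T_N' T_v) as ff.
  split.
  - assert (h : is_fibration F <-> is_essentially_surjective T)
      by exact (fibration_iff_surjective shpV pbQ0 T_F' T_N' T_v
                  (@regular_epi_iso_invariant C)).
    unfold is_weak_equivalence; tauto.
  - refine (iff_trans (fibration_iff_surjective shpV pbQ0 T_F' T_N' T_v
                         (@split_epi_iso_invariant C)) _).
    split.
    + intros [P [ad [bd [pb split_bd]]]].
      exact (proj2 (equivalence_iff_split ff pb) split_bd).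
    + intros eqT.
      destruct (reg_pullback regC (f0 T) (gd V)) as [P [ad [bd pb]]].
      exists P, ad, bd; split; [exact pb|].
      exact (proj1 (equivalence_iff_split ff pb) eqT).
Qed.
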